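(* Let $m,n$ be arbitrary nonnegative integers and let $a,b,\beta$ be complex numbers such that neither $b$ nor $b+\beta$ belongs to $\{0,-1,-2,\ldots\}$. Then $$ \sum_{k=0}^{m}\frac{(a)_k(a+\beta)_{m-k}}{(b)_k(b+\beta)_{m-k}}\left\{\frac{(a+k)_{n+1}}{(b+k)_{n+1}}-\frac{(a+\beta+m-k)_{n+1}}{(b+\beta+m-k)_{n+1}}\right\} $$ $$ =\sum_{j=0}^{n}\frac{(a)_j(a+\beta)_{n-j}}{(b)_j(b+\beta)_{n-j}}\left\{\frac{(a+j)_{m+1}}{(b+j)_{m+1}}-\frac{(a+\beta+n-j)_{m+1}}{(b+\beta+n-j)_{m+1}}\right\}. $$
   Context: $(p)_0=1$ and $(p)_n=p(p+1)\cdots(p+n-1)$ is the Pochhammer symbol. *)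

(* Defs.v *)
From mathcomp Require Import all_boot all_order all_algebra.
Set Implicit Arguments.
Unset Strict Implicit.
Unset Printing Implicit Defensive.
Import GRing.Theory.
Local Open Scope ring_scope.

(* Rising, not falling: (x)_n = x (x + 1) ... (x + n - 1). *)
Definition pochhammer (K : nzRingType) (x : K) (n : nat) : K :=
  \prod_(i < n) (x + i%:R).

(* Main.v *)
(* With u_k = (a)_k / (b)_k, v_k = (a + beta)_k / (b + beta)_k and N = m + n + 1,
   the rule (x)_k (x + k)_l = (x)_(k + l) turns each summand on the left into
   u_(k+n+1) v_(m-k) - u_k v_(N-k).  Writing w_i = u_i v_(N-i) and S_j for the sum
   of w_i over i <= j, the left side is S_N - S_n - S_m, symmetric in m and n. *)

Require Import Defs.
From mathcomp Require Import all_boot all_order all_algebra.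
From mathcomp Require Import reals complex.
Set Implicit Arguments.
Unset Strict Implicit.
Unset Printing Implicit Defensive.
Import Order.TTheory GRing.Theory Num.Theory.
Local Open Scope ring_scope.
Local Open Scope complex_scope.

Lemma pochhammerD (K : nzRingType) (x : K) (k l : nat) :
  pochhammer x (k + l) = pochhammer x k * pochhammer (x + k%:R) l.
Proof.
rewrite /pochhammer big_split_ord /=; congr (_ * _).
by apply: eq_bigr => i _; rewrite natrD addrA.
Qed.

Definition pochhammer_ratio (F : fieldType) (a b : F) (k : nat) : F :=
  pochhammer a k / pochhammer b k.

(** With the convention [0^-1 = 0], inversion in a field is multiplicative on all elements, so the
    splitting rule for rising factorials passes to the quotient. *)
Lemma pochhammer_ratioD (F : fieldType) (a b : F) (k l : nat) :
  pochhammer_ratio a b (k + l) =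
  pochhammer_ratio a b k * pochhammer_ratio (a + k%:R) (b + k%:R) l.
Proof. by rewrite /pochhammer_ratio !pochhammerD invfM mulrACA. Qed.

Lemma sum_shifted_convolution (K : nzRingType) (u v : nat -> K) (m n : nat) :
  \sum_(k < m.+1) (u (k + n.+1)%N * v (m - k)%N - u k * v (m - k + n.+1)%N) =
  \sum_(i < (m + n).+2) u i * v ((m + n).+1 - i)%N
  - \sum_(i < n.+1) u i * v ((m + n).+1 - i)%N
  - \sum_(i < m.+1) u i * v ((m + n).+1 - i)%N.
Proof.
rewrite sumrB; congr (_ - _); last first.
  apply: eq_bigr => k _; congr (_ * v _).
  (* Subtraction is truncated: [k <= m] is what lets [n.+1] move inside it. *)
  by rewrite -addnS addnBAC // -ltnS.
(* The range is cut after its first [n.+1] indices: that block cancels, and the rest, reindexed by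
   [i = n.+1 + k], has second index [m - k]. *)
have -> : (m + n).+2 = (n.+1 + m.+1)%N by rewrite addSn addnS addnC.
rewrite big_split_ord /= addrC addrK; apply: eq_bigr => k _.
by rewrite addnC -addnS [(m + _)%N]addnC subnDl.
Qed.

Lemma sum_pochhammer_ratioE (F : fieldType) (a b c d : F) (m n : nat) :
  \sum_(k < m.+1)
     pochhammer a k * pochhammer c (m - k)
     / (pochhammer b k * pochhammer d (m - k))
     * (pochhammer (a + k%:R) n.+1 / pochhammer (b + k%:R) n.+1
        - pochhammer (c + (m - k)%:R) n.+1 / pochhammer (d + (m - k)%:R) n.+1)
  = \sum_(k < m.+1)
      (pochhammer_ratio a b (k + n.+1) * pochhammer_ratio c d (m - k)
       - pochhammer_ratio a b k * pochhammer_ratio c d (m - k + n.+1)).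
Proof.
apply: eq_bigr => k _; rewrite !pochhammer_ratioD invfM mulrACA mulrBr.
(* The first quotient in the braces extends the ratio at [k], the second the one at [m - k]. *)
by rewrite [X in X - _]mulrAC -[X in _ - X]mulrA.
Qed.

Theorem corollary2 (R : realType) (m n : nat) (a b beta : R[i])
    (hb : forall i : nat, b <> - i%:R)
    (hbbeta : forall i : nat, b + beta <> - i%:R) :
  \sum_(k < m.+1)
     pochhammer a k * pochhammer (a + beta) (m - k)
     / (pochhammer b k * pochhammer (b + beta) (m - k))
     * (pochhammer (a + k%:R) n.+1 / pochhammer (b + k%:R) n.+1
        - pochhammer (a + beta + (m - k)%:R) n.+1
          / pochhammer (b + beta + (m - k)%:R) n.+1)
  = \sum_(j < n.+1)
     pochhammer a j * pochhammer (a + beta) (n - j)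
     / (pochhammer b j * pochhammer (b + beta) (n - j))
     * (pochhammer (a + j%:R) m.+1 / pochhammer (b + j%:R) m.+1
        - pochhammer (a + beta + (n - j)%:R) m.+1
          / pochhammer (b + beta + (n - j)%:R) m.+1).
Proof.
(* Both sides are now the same full sum minus the same two partial sums, taken away in opposite
   orders. *)
rewrite !sum_pochhammer_ratioE !sum_shifted_convolution [(n + m)%N]addnC.
exact: addrAC.
Qed.
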